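(* Let $\varphi$ be a holomorphic self-map of the unit disk $\mathbb{D}$ with $\varphi(0)=0$ and $0<|\varphi'(0)|<1$, and let $u$ be a holomorphic function on $\mathbb{D}$ with $u(0)\neq0$. Let $\sigma$ be the Königs function of $\varphi$ and $v$ the principal eigenfunction of $uC_\varphi$. Let $\beta>0$ be fixed and assume $$|u(z)|\,\frac{(1-|z|^2)^\beta}{(1-|\varphi(z)|^2)^\beta}\le|u(0)|\qquad\text{for all } z\in\mathbb{D}.$$ Then: (i) If for some $0<\alpha<1$ one has $\dfrac{(1-|z|^2)^\alpha|\varphi'(z)|}{(1-|\varphi(z)|^2)^\alpha}\le|\varphi'(0)|$ for all $z\in\mathbb{D}$, then $v\sigma^n\in\mathcal{B}_{\beta+1}$ for all non-negative integers $n$. (ii) If $\dfrac{(1-|z|^2)|\varphi'(z)|}{1-|\varphi(z)|^2}\le|\varphi'(0)|$ for all $z\in\mathbb{D}$, then for some $p>\beta$ one has $v\sigma^n\in\mathcal{B}_{p+1}$ for all non-negative integers $n$.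
   Context: $\mathbb{D}$ is the open unit disk in the complex plane. For $\alpha>0$, the Bloch-type space $\mathcal{B}_\alpha$ is the set of holomorphic $f$ on $\mathbb{D}$ with $\sup_{z\in\mathbb{D}}(1-|z|^2)^\alpha|f'(z)|<\infty$. The weighted composition operator is $uC_\varphi f=u\cdot(f\circ\varphi)$. $\varphi_k$ denotes the $k$-th iterate of $\varphi$ (with $\varphi_0(z)=z$). When $\varphi(0)=0$ and $0<|\varphi'(0)|<1$, the Königs function $\sigma$ of $\varphi$ is the holomorphic function $\sigma=\lim_{k\to\infty}\varphi_k/\varphi'(0)^k$ (the limit exists uniformly on compact subsets of $\mathbb{D}$ by Königs's theorem); it satisfies $\sigma\circ\varphi=\varphi'(0)\sigma$. When moreover $u(0)\neq0$, the principal eigenfunction $v$ of $uC_\varphi$ is the holomorphic function $v=\lim_{k\to\infty}v_k$ on $\mathbb{D}$, where $v_k(z)=\dfrac{u(z)u(\varphi(z))\cdots u(\varphi_{k-1}(z))}{u(0)^k}$ (the limit is known to exist); it satisfies $u\cdot(v\circ\varphi)=u(0)v$. *)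

(* Defs.v *)
From Stdlib Require Import Reals.
From Coquelicot Require Import Coquelicot.
Open Scope R_scope.

Definition in_disk (z : C) : Prop := Cmod z < 1.

(* Functions on the disk are represented by total functions on [C] whose values
   outside the disk are irrelevant: the disk being open, complex
   differentiability and [C_derive] at its points only see values inside it. *)
Definition holomorphic_on_disk (f : C -> C) : Prop :=
  forall z : C, in_disk z -> ex_derive (K := C_AbsRing) f z.

Definition holomorphic_self_map (phi : C -> C) : Prop :=
  holomorphic_on_disk phi /\ forall z : C, in_disk z -> in_disk (phi z).

(* [Rpower x a] is the genuine power x^a here, since 1 - |z|^2 > 0 on the
   disk. *)
Definition in_Bloch (a : R) (f : C -> C) : Prop :=
  holomorphic_on_disk f /\
  exists M : R, forall z : C, in_disk z ->
    Rpower (1 - Cmod z ^ 2) a * Cmod (C_derive f z) <= M.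

Definition iterate (phi : C -> C) (k : nat) (z : C) : C := Nat.iter k phi z.

Definition lim_on_disk (F : nat -> C -> C) (f : C -> C) : Prop :=
  forall z : C, in_disk z ->
    filterlim (fun k : nat => F k z) eventually (locally (f z)).

(* The limit determines [sigma] on the disk. Pointwise convergence is all that
   is required; by Koenigs's theorem it is automatically locally uniform. *)
Definition is_Koenigs_function (phi sigma : C -> C) : Prop :=
  holomorphic_on_disk sigma /\
  lim_on_disk
    (fun k z => (iterate phi k z / Cpow (C_derive phi (RtoC 0)) k)%C) sigma.

Fixpoint Cprod (f : nat -> C) (k : nat) : C :=
  match k with
  | O => RtoC 1
  | S j => (Cprod f j * f j)%C
  end.

Definition is_principal_eigenfunction (u phi v : C -> C) : Prop :=
  holomorphic_on_disk v /\
  lim_on_disk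
    (fun k z => (Cprod (fun j => u (iterate phi j z)) k
                 / Cpow (u (RtoC 0)) k)%C) v.

(* Main.v *)
Require Import Defs.
From Stdlib Require Import Reals Lra.
From Coquelicot Require Import Coquelicot.
Open Scope R_scope.

(* Iterating the hypotheses on u and phi' bounds v_k by (1 - |z|^2)^(-beta) and
   phi_k' by |phi'(0)|^k (1 - |z|^2)^(-alpha).  Integrating the second bound along
   the radius to z and letting k tend to infinity shows that sigma is bounded when
   alpha < 1; when alpha = 1, weakening the exponent to 1 + 1/(n+1) first shows
   that sigma^n is at most a multiple of (1 - |z|)^(-1).  The growth of v sigma^n
   gives the growth of its derivative by a Cauchy estimate.  As holomorphy means
   mere complex differentiability, this estimate rests on Goursat's argument. *)

(** * Goursat's theorem *)

(** No path integral is set up. In the variables (r, t) an annulus is a rectangle, and the polar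
    Cauchy-Riemann equation for f(w)/w says that a plane field is divergence free, so Goursat's
    bisection is run on rectangles in (r, t). The iterated bounds are uniform in k because the
    weights telescope along an orbit: the last weight is at most 1, and the accumulated factor
    |u(0)|^k or |phi'(0)|^k is exactly the one divided out in v_k and in the definition of sigma.
    For alpha = 1 the primitive of the bound is a logarithm. With g = 1/(n+1), the exponent 1 + g
    keeps everything a power: sigma grows at most like (1 - |z|)^(-g), and sigma^n costs the power n
    g < 1 whatever n is. One extra power of the weight therefore serves all n at once, whence p =
    beta + 1; only the constant (n+1)^n depends on n. *)

Lemma nested_intervals (a b : nat -> R) :
  (forall n, a n <= a (S n)) -> (forall n, b (S n) <= b n) ->
  (forall n, a n <= b n) -> exists x, forall n, a n <= x <= b n.
Proof.
  intros ha hb hab.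
  assert (hal : forall n k, a n <= a (n + k)%nat).
  { intros n k; induction k as [|k IH].
    - rewrite Nat.add_0_r; lra.
    - rewrite Nat.add_succ_r; specialize (ha (n + k)%nat); lra. }
  assert (hbl : forall n k, b (n + k)%nat <= b n).
  { intros n k; induction k as [|k IH].
    - rewrite Nat.add_0_r; lra.
    - rewrite Nat.add_succ_r; specialize (hb (n + k)%nat); lra. }
  assert (hcross : forall m n, a m <= b n).
  { intros m n; specialize (hal m n); specialize (hbl n m).
    rewrite (Nat.add_comm n m) in hbl; specialize (hab (m + n)%nat); lra. }
  destruct (completeness (fun y => exists n, y = a n)) as [x [hub hlub]].
  - exists (b 0%nat); intros y [n ->]; apply hcross.
  - exists (a 0%nat), 0%nat; reflexivity.
  - exists x; intros n; split.
    + apply hub; exists n; reflexivity.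
    + apply hlub; intros y [m ->]; apply hcross.
Qed.

Record rect := Rect { xl : R; xr : R; yl : R; yr : R }.

(** The ordering of the sides of [r] is included, so [sub_rect r r] says that [r] is a genuine,
    possibly degenerate, rectangle. *)
Definition sub_rect (r s : rect) : Prop :=
  xl s <= xl r <= xr r /\ xr r <= xr s /\ yl s <= yl r <= yr r /\ yr r <= yr s.

Definition quarter (i j : bool) (r : rect) : rect :=
  let mx := (xl r + xr r) / 2 in
  let my := (yl r + yr r) / 2 in
  Rect (if i then mx else xl r) (if i then xr r else mx)
       (if j then my else yl r) (if j then yr r else my).

Definition heavy_quarter (Q : rect -> R) (r : rect) : rect :=
  let heavy s := Rle_dec (Rabs (Q r)) (4 * Rabs (Q s)) in
  if heavy (quarter false false r) then quarter false false r
  else if heavy (quarter false true r) then quarter false true r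
  else if heavy (quarter true false r) then quarter true false r
  else quarter true true r.

(** The fourth quarter is chosen without a test: if the other three each carry less than a quarter
    of [Rabs (Q r)], the triangle inequality leaves at least a quarter for it. *)
Lemma heavy_quarter_spec (Q : rect -> R) (r : rect) :
  Q r = Q (quarter false false r) + Q (quarter false true r)
        + Q (quarter true false r) + Q (quarter true true r) ->
  (exists i j, heavy_quarter Q r = quarter i j r) /\
  Rabs (Q r) <= 4 * Rabs (Q (heavy_quarter Q r)).
Proof.
  intros hadd; unfold heavy_quarter.
  destruct (Rle_dec _ _) as [h1|h1]; [split; eauto|].
  destruct (Rle_dec _ _) as [h2|h2]; [split; eauto|].
  destruct (Rle_dec _ _) as [h3|h3]; [split; eauto|].
  split; [eauto|].
  apply Rnot_le_lt in h1, h2, h3.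
  revert h1 h2 h3; rewrite hadd; unfold Rabs; repeat destruct (Rcase_abs _); lra.
Qed.

(* Goursat's argument: an additive function of rectangles that is
   infinitesimal compared to the area around every point vanishes. *)
Lemma additive_rect_function_zero (Q : rect -> R) (r0 : rect) :
  sub_rect r0 r0 ->
  (forall r, sub_rect r r0 ->
     Q r = Q (quarter false false r) + Q (quarter false true r)
           + Q (quarter true false r) + Q (quarter true true r)) ->
  (forall x y eps, xl r0 <= x <= xr r0 -> yl r0 <= y <= yr r0 -> 0 < eps ->
     exists delta, 0 < delta /\ forall r, sub_rect r r0 ->
       xl r <= x <= xr r -> yl r <= y <= yr r ->
       (xr r - xl r) + (yr r - yl r) < delta ->
       Rabs (Q r) <= eps * ((xr r - xl r) + (yr r - yl r)) ^ 2) ->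
  Q r0 = 0.
Proof.
  intros hr0 hadd hloc.
  set (s := fun n => Nat.iter n (heavy_quarter Q) r0).
  set (L := (xr r0 - xl r0) + (yr r0 - yl r0)).
  assert (hs : forall n, sub_rect (s n) r0).
  { induction n as [|n IH]; [exact hr0|].
    destruct (heavy_quarter_spec Q (s n) (hadd _ IH)) as [(i & j & h) _].
    change (s (S n)) with (heavy_quarter Q (s n)); rewrite h.
    revert IH; unfold sub_rect, quarter; destruct i, j; simpl; lra. }
  assert (hstep : forall n, exists i j, s (S n) = quarter i j (s n)).
  { intros n; apply heavy_quarter_spec, hadd, hs. }
  assert (hsize : forall n,
    (xr (s n) - xl (s n)) + (yr (s n) - yl (s n)) = L * (/ 2) ^ n).
  { induction n as [|n IH]; [unfold L; simpl; ring|].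
    destruct (hstep n) as (i & j & h); rewrite h, <- tech_pow_Rmult.
    replace (L * (/ 2 * (/ 2) ^ n)) with (/ 2 * (L * (/ 2) ^ n)) by ring.
    rewrite <- IH; unfold quarter; destruct i, j; simpl; lra. }
  assert (hQ : forall n, Rabs (Q r0) * (/ 4) ^ n <= Rabs (Q (s n))).
  { induction n as [|n IH]; [simpl; lra|].
    pose proof (proj2 (heavy_quarter_spec Q (s n) (hadd _ (hs n)))) as h.
    change (s (S n)) with (heavy_quarter Q (s n)).
    rewrite <- tech_pow_Rmult; lra. }
  destruct (nested_intervals (fun n => xl (s n)) (fun n => xr (s n)))
    as [x hx];
    [intros n; destruct (hstep n) as (i & j & h); rewrite h;
     specialize (hs n); revert hs; unfold sub_rect, quarter;
     destruct i, j; simpl; lra ..|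
     intros n; specialize (hs n); unfold sub_rect in hs; lra|].
  destruct (nested_intervals (fun n => yl (s n)) (fun n => yr (s n)))
    as [y hy];
    [intros n; destruct (hstep n) as (i & j & h); rewrite h;
     specialize (hs n); revert hs; unfold sub_rect, quarter;
     destruct i, j; simpl; lra ..|
     intros n; specialize (hs n); unfold sub_rect in hs; lra|].
  destruct (Req_dec (Q r0) 0) as [h0|h0]; [exact h0|exfalso].
  apply Rabs_pos_lt in h0.
  assert (hL : 0 <= L) by (unfold L, sub_rect in *; lra).
  (* The factors 4^(-n) in [hQ] and in the local bound cancel, leaving [Rabs (Q r0) <= eps * L ^ 2];
     this [eps] contradicts that. Here and in [delta / (L + 1)] the added 1 covers [L = 0]. *)
  set (eps := Rabs (Q r0) / (2 * (L ^ 2 + 1))).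
  assert (hL2 : 0 <= L ^ 2) by apply pow2_ge_0.
  assert (heps : 0 < eps) by (apply Rdiv_lt_0_compat; lra).
  destruct (hloc x y eps (hx 0%nat) (hy 0%nat) heps) as (delta & hd & hbound).
  destruct (pow_lt_1_zero (/ 2) ltac:(rewrite Rabs_pos_eq; lra)
              (delta / (L + 1)) ltac:(apply Rdiv_lt_0_compat; lra)) as [n hn].
  specialize (hn n (Nat.le_refl n)).
  assert (hpn : 0 < (/ 2) ^ n) by (apply pow_lt; lra).
  rewrite Rabs_pos_eq in hn by lra.
  apply (Rmult_lt_compat_l (L + 1)) in hn; [|lra].
  replace ((L + 1) * (delta / (L + 1))) with delta in hn by (field; lra).
  specialize (hbound (s n) (hs n) (hx n) (hy n)).
  rewrite hsize in hbound.
  specialize (hbound ltac:(nra)); specialize (hQ n).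
  assert (h4 : (/ 4) ^ n = (/ 2) ^ n * (/ 2) ^ n).
  { rewrite <- Rpow_mult_distr; f_equal; lra. }
  assert (h5 : Rabs (Q r0) <= eps * L ^ 2).
  { apply (Rmult_le_reg_r ((/ 4) ^ n)); [apply pow_lt; lra|].
    rewrite h4 in *; nra. }
  assert (h6 : Rabs (Q r0) = eps * (2 * (L ^ 2 + 1))) by (unfold eps; field; lra).
  nra.
Qed.

(** * The divergence theorem on rectangles *)

Lemma differentiable_continuous_x (A : R -> R -> R) (x y lx ly : R) :
  differentiable_pt_lim A x y lx ly -> continuous (fun u => A u y) x.
Proof.
  intros h; apply (ex_derive_continuous (fun u => A u y)).
  exists (lx * 1 + ly * 0); apply is_derive_Reals.
  apply (derivable_pt_lim_comp_2d A (fun u => u) (fun _ => y) x _ _ 1 0 h).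
  - apply derivable_pt_lim_id.
  - apply derivable_pt_lim_const.
Qed.

Lemma differentiable_continuous_y (A : R -> R -> R) (x y lx ly : R) :
  differentiable_pt_lim A x y lx ly -> continuous (fun u => A x u) y.
Proof.
  intros h; apply (ex_derive_continuous (fun u => A x u)).
  exists (lx * 0 + ly * 1); apply is_derive_Reals.
  apply (derivable_pt_lim_comp_2d A (fun _ => x) (fun u => u) y _ _ 0 1 h).
  - apply derivable_pt_lim_const.
  - apply derivable_pt_lim_id.
Qed.

Lemma RInt_near_const (g : R -> R) (c d k e : R) :
  c <= d -> ex_RInt g c d -> (forall t, c <= t <= d -> Rabs (g t - k) <= e) ->
  Rabs (RInt g c d - k * (d - c)) <= (d - c) * e.
Proof.
  intros hcd hg hb.
  assert (hk : ex_RInt (fun _ : R => k) c d) by apply ex_RInt_const.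
  replace (RInt g c d - k * (d - c)) with (RInt (fun t => g t - k) c d).
  - apply abs_RInt_le_const; auto.
    apply (ex_RInt_minus g (fun _ => k)); auto.
  - rewrite (RInt_minus g (fun _ => k)) by auto.
    rewrite RInt_const; unfold minus, plus, opp, scal; simpl; unfold mult; simpl; ring.
Qed.

(* The divergence theorem for the field (A, -B), whose divergence vanishes: the
   derivative [l] of [A] in [x] is also that of [B] in [y]. *)
Lemma rectangle_divergence (A B : R -> R -> R) (a b c d : R) :
  a <= b -> c <= d ->
  (forall x y, a <= x <= b -> c <= y <= d -> exists l lA lB,
     differentiable_pt_lim A x y l lA /\ differentiable_pt_lim B x y lB l) ->
  RInt (A b) c d - RInt (A a) c d
  = RInt (fun x => B x d) a b - RInt (fun x => B x c) a b.
Proof.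
  intros hab hcd hdiff.
  assert (hA : forall x y1 y2, a <= x <= b -> c <= y1 -> y1 <= y2 -> y2 <= d ->
    ex_RInt (A x) y1 y2).
  { intros x y1 y2 hx h1 h2 h3; apply (ex_RInt_continuous (V := R_CompleteNormedModule)); intros y hy.
    rewrite Rmin_left, Rmax_right in hy by lra.
    destruct (hdiff x y) as (l & lA & lB & h & _); [lra..|].
    exact (differentiable_continuous_y A x y _ _ h). }
  assert (hB : forall x1 x2 y, c <= y <= d -> a <= x1 -> x1 <= x2 -> x2 <= b ->
    ex_RInt (fun x => B x y) x1 x2).
  { intros x1 x2 y hy h1 h2 h3; apply (ex_RInt_continuous (V := R_CompleteNormedModule)); intros x hx.
    rewrite Rmin_left, Rmax_right in hx by lra.
    destruct (hdiff x y) as (l & lA & lB & _ & h); [lra..|].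
    exact (differentiable_continuous_x B x y _ _ h). }
  (* The defect of the claimed identity on [r]; it is additive because the integrals over inner
     sides cancel. *)
  set (Q := fun r : rect =>
    (RInt (A (xr r)) (yl r) (yr r) - RInt (A (xl r)) (yl r) (yr r))
    - (RInt (fun x => B x (yr r)) (xl r) (xr r)
       - RInt (fun x => B x (yl r)) (xl r) (xr r))).
  enough (h : Q (Rect a b c d) = 0) by (unfold Q in h; simpl in h; lra).
  apply additive_rect_function_zero.
  - unfold sub_rect; simpl; lra.
  - intros [a' b' c' d'] hr; unfold sub_rect in hr; simpl in hr.
    unfold Q, quarter; simpl.
    set (m := (a' + b') / 2); set (n := (c' + d') / 2).
    assert (hm : a' <= m <= b') by (unfold m; lra).
    assert (hn : c' <= n <= d') by (unfold n; lra).
    assert (eA : forall x, a <= x <= b ->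
      RInt (A x) c' d' = RInt (A x) c' n + RInt (A x) n d').
    { intros x hx; symmetry; apply (RInt_Chasles (A x)); apply hA; lra. }
    assert (eB : forall y, c <= y <= d ->
      RInt (fun x => B x y) a' b'
      = RInt (fun x => B x y) a' m + RInt (fun x => B x y) m b').
    { intros y hy; symmetry; apply (RInt_Chasles (fun x => B x y)); apply hB; lra. }
    rewrite (eA a'), (eA b'), (eB c'), (eB d') by lra; ring.
  - intros x y eps hx hy heps; simpl in hx, hy.
    destruct (hdiff x y hx hy) as (l & lA & lB & h1 & h2).
    assert (heps4 : 0 < eps / 4) by lra.
    destruct (h1 (mkposreal _ heps4)) as [d1 hd1].
    destruct (h2 (mkposreal _ heps4)) as [d2 hd2].
    exists (Rmin d1 d2); split.
    { apply Rmin_pos; apply cond_pos. }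
    intros [a' b' c' d'] hr hx' hy' hsize; unfold sub_rect in hr; simpl in *.
    set (s := (b' - a') + (d' - c')) in *.
    assert (hm1 := Rmin_l d1 d2); assert (hm2 := Rmin_r d1 d2).
    (* In the difference of two opposite sides the terms in [lA] cancel, leaving [l] times the area
       up to two errors of [eps / 4 * s]. The same holds for [B] with the same [l], so the main
       terms cancel in [Q]. *)
    assert (eA : Rabs (RInt (fun t => A b' t - A a' t) c' d'
                       - l * (b' - a') * (d' - c')) <= (d' - c') * (eps / 2 * s)).
    { apply RInt_near_const; [lra| |].
      - apply (ex_RInt_minus (A b') (A a')); apply hA; lra.
      - intros t ht.
        assert (hc : forall u, a' <= u <= b' ->
          Rabs (A u t - A x y - (l * (u - x) + lA * (t - y))) <= eps / 4 * s).
        { intros u hu; eapply Rle_trans; [apply hd1|].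
          - unfold s in *; split_Rabs; lra.
          - unfold s in *; split_Rabs; lra.
          - apply Rmult_le_compat_l; [lra|].
            apply Rmax_lub; unfold s in *; split_Rabs; lra. }
        assert (g1 := hc b' ltac:(lra)); assert (g2 := hc a' ltac:(lra)).
        split_Rabs; lra. }
    assert (eB : Rabs (RInt (fun t => B t d' - B t c') a' b'
                       - l * (d' - c') * (b' - a')) <= (b' - a') * (eps / 2 * s)).
    { apply RInt_near_const; [lra| |].
      - apply (ex_RInt_minus (fun t => B t d') (fun t => B t c')); apply hB; lra.
      - intros t ht.
        assert (hc : forall u, c' <= u <= d' ->
          Rabs (B t u - B x y - (lB * (t - x) + l * (u - y))) <= eps / 4 * s).
        { intros u hu; eapply Rle_trans; [apply hd2|].
          - unfold s in *; split_Rabs; lra.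
          - unfold s in *; split_Rabs; lra.
          - apply Rmult_le_compat_l; [lra|].
            apply Rmax_lub; unfold s in *; split_Rabs; lra. }
        assert (g1 := hc c' ltac:(lra)); assert (g2 := hc d' ltac:(lra)).
        split_Rabs; lra. }
    rewrite (RInt_minus (A b') (A a')) in eA by (apply hA; lra).
    rewrite (RInt_minus (fun t => B t d') (fun t => B t c')) in eB
      by (apply hB; lra).
    unfold Q, minus, plus, opp in *; simpl in *.
    assert (hs : s * s * (eps / 2) <= eps * (s * (s * 1))).
    { assert (0 <= s * s) by nra. nra. }
    assert ((d' - c') * (eps / 2 * s) + (b' - a') * (eps / 2 * s)
            = s * s * (eps / 2)) by (unfold s; ring).
    split_Rabs; lra.
Qed.

(** * The Cauchy estimate *)

Lemma is_derive_C_eps (f : C -> C) (z l : C) :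
  is_derive (K := C_AbsRing) f z l -> forall eps : R, 0 < eps ->
  exists delta, 0 < delta /\ forall w, Cmod (w - z) < delta ->
    Cmod (f w - f z - l * (w - z)) <= eps * Cmod (w - z).
Proof.
  intros [_ h] eps heps.
  specialize (h z (fun P hP => hP) (mkposreal _ heps)).
  destruct h as [d hd]; exists d; split; [apply cond_pos|].
  intros w hw; specialize (hd w hw).
  rewrite Cmult_comm.
  exact hd.
Qed.

(** The Cauchy-Riemann equations, read off from the real and imaginary parts of [l * (w - z)]. *)
Lemma differentiable_pt_lim_Re_Im (f : C -> C) (x y : R) (l : C) :
  is_derive (K := C_AbsRing) f (x, y) l ->
  differentiable_pt_lim (fun u v => Re (f (u, v))) x y (Re l) (- Im l) /\
  differentiable_pt_lim (fun u v => Im (f (u, v))) x y (Im l) (Re l).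
Proof.
  intros h.
  assert (hmain : forall eps : posreal, exists d : posreal, forall u v,
    Rabs (u - x) < d -> Rabs (v - y) < d ->
    Cmod (f (u, v) - f (x, y) - l * ((u, v) - (x, y)))
    <= eps * Rmax (Rabs (u - x)) (Rabs (v - y))).
  { intros eps.
    (* [differentiable_pt_lim] measures increments in the max norm; [Cmod] is at most sqrt 2 <= 2
       times that norm, hence the halves of [eps] and [d]. *)
    assert (heps : 0 < eps / 2) by (destruct eps; simpl; lra).
    destruct (is_derive_C_eps f _ l h _ heps) as (d & hd0 & hd).
    assert (hd2 : 0 < d / 2) by lra.
    exists (mkposreal _ hd2); simpl; intros u v hu hv.
    assert (hsq : sqrt 2 <= 2).
    { rewrite <- (sqrt_pow2 2) at 2 by lra. apply sqrt_le_1; lra. }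
    assert (hmax : Cmod ((u, v) - (x, y)) <= 2 * Rmax (Rabs (u - x)) (Rabs (v - y))).
    { eapply Rle_trans; [apply Cmod_2Rmax|].
      apply Rmult_le_compat_r; [|lra].
      eapply Rle_trans; [apply Rabs_pos|apply Rmax_l]. }
    eapply Rle_trans; [apply hd|].
    - eapply Rle_lt_trans; [exact hmax|].
      assert (Rmax (Rabs (u - x)) (Rabs (v - y)) < d / 2)
        by (apply Rmax_lub_lt; assumption); lra.
    - apply (Rmult_le_compat_l (eps / 2)) in hmax; lra. }
  split; intros eps; destruct (hmain eps) as [d hd]; exists d; intros u v hu hv;
    (eapply Rle_trans; [|apply (hd u v hu hv)]).
  - eapply Rle_trans; [|apply re_le_Cmod].
    right; f_equal; destruct l; simpl; unfold Re, Im; simpl; ring.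
  - eapply Rle_trans; [|eapply Rle_trans; [apply Rmax_r|apply Rmax_Cmod]].
    right; f_equal; destruct l; simpl; unfold Re, Im; simpl; ring.
Qed.

(** * Differentiability in polar coordinates *)

Lemma differentiable_pt_lim_snd (g : R -> R) (x y l : R) :
  derivable_pt_lim g y l -> differentiable_pt_lim (fun _ v => g v) x y 0 l.
Proof.
  intros h.
  assert (h2 : differentiable_pt_lim (fun _ v : R => v) x y 0 1).
  { intros eps; exists eps; intros u v _ _.
    replace (v - y - (0 * (u - x) + 1 * (v - y))) with 0 by ring.
    rewrite Rabs_R0; apply Rmult_le_pos; [apply Rlt_le, cond_pos|].
    eapply Rle_trans; [apply Rabs_pos|apply Rmax_l]. }
  replace 0 with (l * 0 + 0 * 0) by ring.
  replace l with (l * 1 + 0 * 1) at 2 by ring.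
  apply (differentiable_pt_lim_comp (fun a _ => g a) (fun _ v => v) (fun _ v => v)); auto.
  apply differentiable_pt_lim_proj1_0; exact h.
Qed.

Lemma differentiable_pt_lim_plus (f g : R -> R -> R) (x y fx fy gx gy : R) :
  differentiable_pt_lim f x y fx fy -> differentiable_pt_lim g x y gx gy ->
  differentiable_pt_lim (fun u v => f u v + g u v) x y (fx + gx) (fy + gy).
Proof.
  intros hf hg.
  replace (fx + gx) with (1 * fx + 1 * gx) by ring.
  replace (fy + gy) with (1 * fy + 1 * gy) by ring.
  apply (differentiable_pt_lim_comp (fun a b => a + b) f g); auto.
  intros eps; exists eps; intros u v _ _.
  replace (_ - _ - _) with 0 by ring.
  rewrite Rabs_R0; apply Rmult_le_pos; [apply Rlt_le, cond_pos|].
  eapply Rle_trans; [apply Rabs_pos|apply Rmax_l].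
Qed.

Lemma differentiable_pt_lim_mult (f g : R -> R -> R) (x y fx fy gx gy : R) :
  differentiable_pt_lim f x y fx fy -> differentiable_pt_lim g x y gx gy ->
  differentiable_pt_lim (fun u v => f u v * g u v) x y
    (g x y * fx + f x y * gx) (g x y * fy + f x y * gy).
Proof.
  intros hf hg.
  apply (differentiable_pt_lim_comp (fun a b => a * b) f g); auto.
  intros eps; exists eps; intros u v hu _.
  replace (_ - _ - _) with ((u - f x y) * (v - g x y)) by ring.
  rewrite Rabs_mult; apply Rmult_le_compat; try apply Rabs_pos; [lra|apply Rmax_r].
Qed.

(* These are the real part of f(w)e^{-it}/r and the imaginary part of
   f(w)e^{-it}/r^2 at w = re^{it}. *)
Definition polar_re (f : C -> C) (r t : R) : R :=
  (Re (f (r * cos t, r * sin t)) * cos t + Im (f (r * cos t, r * sin t)) * sin t) * / r.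

Definition polar_im (f : C -> C) (r t : R) : R :=
  (Im (f (r * cos t, r * sin t)) * cos t + Re (f (r * cos t, r * sin t)) * - sin t)
  * (/ r * / r).

(** At w = re^{it}, [polar_re] is the real part of f(w)/w and [polar_im] is its imaginary part
    divided by r. The common value of the two partial derivatives is the polar Cauchy-Riemann
    equation for f(w)/w. *)
Lemma polar_divergence_free (f : C -> C) (r t : R) :
  r <> 0 -> ex_derive (K := C_AbsRing) (V := C_NormedModule) f (r * cos t, r * sin t) ->
  exists l lA lB,
    differentiable_pt_lim (polar_re f) r t l lA /\
    differentiable_pt_lim (polar_im f) r t lB l.
Proof.
  intros hr [l hl].
  destruct (differentiable_pt_lim_Re_Im f _ _ l hl) as [hp hq].
  assert (hid : differentiable_pt_lim (fun u _ => u) r t 1 0)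
    by apply (differentiable_pt_lim_proj1_0 (fun u => u)), derivable_pt_lim_id.
  assert (hcos := differentiable_pt_lim_snd cos r t _ (derivable_pt_lim_cos t)).
  assert (hsin := differentiable_pt_lim_snd sin r t _ (derivable_pt_lim_sin t)).
  assert (hnsin : differentiable_pt_lim (fun _ v => - sin v) r t 0 (- cos t)).
  { apply (differentiable_pt_lim_snd (fun v => - sin v)).
    apply (derivable_pt_lim_opp sin), derivable_pt_lim_sin. }
  assert (hinv : differentiable_pt_lim (fun u _ => / u) r t (- / r ^ 2) 0).
  { apply (differentiable_pt_lim_proj1_0 (fun u => / u)).
    apply is_derive_Reals; auto_derive; [exact hr|field; exact hr]. }
  assert (hX := differentiable_pt_lim_mult _ _ _ _ _ _ _ _ hid hcos).
  assert (hY := differentiable_pt_lim_mult _ _ _ _ _ _ _ _ hid hsin).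
  assert (hpp := differentiable_pt_lim_comp _ _ _ _ _ _ _ _ _ _ _ hp hX hY).
  assert (hqq := differentiable_pt_lim_comp _ _ _ _ _ _ _ _ _ _ _ hq hX hY).
  assert (hA := differentiable_pt_lim_mult _ _ _ _ _ _ _ _
    (differentiable_pt_lim_plus _ _ _ _ _ _ _ _
      (differentiable_pt_lim_mult _ _ _ _ _ _ _ _ hpp hcos)
      (differentiable_pt_lim_mult _ _ _ _ _ _ _ _ hqq hsin)) hinv).
  assert (hB := differentiable_pt_lim_mult _ _ _ _ _ _ _ _
    (differentiable_pt_lim_plus _ _ _ _ _ _ _ _
      (differentiable_pt_lim_mult _ _ _ _ _ _ _ _ hqq hcos)
      (differentiable_pt_lim_mult _ _ _ _ _ _ _ _ hpp hnsin))
    (differentiable_pt_lim_mult _ _ _ _ _ _ _ _ hinv hinv)).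
  cbv beta in hA, hB.
  (* It remains to see that the two values produced by the product rule agree: up to powers of [r],
     a polynomial identity modulo sin^2 + cos^2 = 1. *)
  match type of hB with differentiable_pt_lim _ _ _ _ ?a =>
    match type of hA with differentiable_pt_lim _ _ _ ?b _ =>
      enough (e : a = b) by (rewrite e in hB; eexists _, _, _; split; [exact hA|exact hB])
    end end.
  assert (hcs : sin t * sin t = 1 - cos t * cos t).
  { pose proof (sin2_cos2 t) as h; unfold Rsqr in h; lra. }
  set (p := Re (f _)); set (q := Im (f _)).
  apply (Rmult_eq_reg_r (r * r)); [|nra].
  field_simplify; [|exact hr|exact hr].
  replace (sin t ^ 2) with (1 - cos t * cos t) by (rewrite <- hcs; ring).
  field; exact hr.
Qed.

(** The product and composition rules below pass through [AbsRing_NormedModule C_AbsRing]. The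
    approximation conditions of the two structures are convertible, so only linearity is proved
    anew. *)
Lemma is_derive_C_AbsRing (f : C -> C) (z l : C) :
  is_derive (K := C_AbsRing) (V := C_NormedModule) f z l <->
  is_derive (K := C_AbsRing) (V := AbsRing_NormedModule C_AbsRing) f z l.
Proof.
  split; intros [_ h]; (split; [apply is_linear_scal_l|exact h]).
Qed.

Lemma is_derive_Cmult (f g : C -> C) (z a b : C) :
  is_derive (K := C_AbsRing) (V := C_NormedModule) f z a ->
  is_derive (K := C_AbsRing) (V := C_NormedModule) g z b ->
  is_derive (K := C_AbsRing) (V := C_NormedModule)
    (fun w => (f w * g w)%C) z (a * g z + f z * b)%C.
Proof.
  rewrite !is_derive_C_AbsRing; intros hf hg.
  exact (is_derive_mult (K := C_AbsRing) f g z a b hf hg Cmult_comm).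
Qed.

Lemma is_derive_Ccomp (f g : C -> C) (z a b : C) :
  is_derive (K := C_AbsRing) (V := C_NormedModule) f (g z) a ->
  is_derive (K := C_AbsRing) (V := C_NormedModule) g z b ->
  is_derive (K := C_AbsRing) (V := C_NormedModule) (fun w => f (g w)) z (b * a)%C.
Proof.
  rewrite (is_derive_C_AbsRing g); intros hf hg.
  exact (is_derive_comp (K := C_AbsRing) f g z a b hf hg).
Qed.

Lemma is_derive_Cscal (c : C) (f : C -> C) (z l : C) :
  is_derive (K := C_AbsRing) (V := C_NormedModule) f z l ->
  is_derive (K := C_AbsRing) (V := C_NormedModule) (fun w => (c * f w)%C) z (c * l)%C.
Proof.
  intros hf; replace (c * l)%C with (RtoC 0 * f z + c * l)%C by ring.
  apply (is_derive_Cmult (fun _ => c)); [|exact hf].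
  exact (is_derive_const (K := C_AbsRing) (V := C_NormedModule) c z).
Qed.

(** Lets an estimate of a real part bound a modulus, by rotating the function first. *)
Lemma ex_rotation_to_Cmod (l : C) :
  exists c : C, Cmod c = 1 /\ (c * l)%C = RtoC (Cmod l).
Proof.
  assert (hl0 := Cmod_ge_0 l).
  destruct (Req_dec (Cmod l) 0) as [h0|h0].
  { exists (RtoC 1); split; [apply Cmod_1|].
    rewrite h0, (Cmod_eq_0 _ h0); ring. }
  assert (hlC : RtoC (Cmod l) <> RtoC 0) by (intros h; apply h0, RtoC_inj, h).
  exists (Cconj l / RtoC (Cmod l))%C; split.
  - rewrite Cmod_div, Cmod_conj, Cmod_R, Rabs_pos_eq by assumption.
    field; assumption.
  - replace (Cconj l / RtoC (Cmod l) * l)%C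
      with ((l * Cconj l) / RtoC (Cmod l))%C by (field; assumption).
    rewrite <- Cmod2_conj; simpl; rewrite Rmult_1_r, RtoC_mult.
    field; assumption.
Qed.

(** The quantity on the left is the real part of we^{-it}. *)
Lemma rotate_re_le (w : C) (t : R) :
  Rabs (Re w * cos t + Im w * sin t) <= Cmod w.
Proof.
  assert (h1 : Cmod (cos t, - sin t) = 1).
  { unfold Cmod; simpl fst; simpl snd.
    rewrite <- sqrt_1; f_equal; pose proof (sin2_cos2 t) as h; unfold Rsqr in h; nra. }
  rewrite <- (Rmult_1_r (Cmod w)), <- h1, <- Cmod_mult.
  eapply Rle_trans; [|apply re_le_Cmod].
  right; f_equal; destruct w; unfold Re, Im; simpl; ring.
Qed.

Lemma Cmod_polar (r t : R) : 0 <= r -> Cmod (r * cos t, r * sin t) = r.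
Proof.
  intros hr; unfold Cmod; simpl fst; simpl snd.
  replace (_ + _) with (r ^ 2); [apply sqrt_pow2, hr|].
  pose proof (sin2_cos2 t) as h; unfold Rsqr in h.
  transitivity (r ^ 2 * (sin t * sin t + cos t * cos t)); [rewrite h|]; ring.
Qed.

(* By the divergence theorem in polar coordinates the mean of
   [Re (f(re^{it}) / (re^{it}))] over the circle does not depend on [r]; it
   tends to [Re l] as [r] tends to [0]. *)
Lemma cauchy_estimate_at_zero (f : C -> C) (l : C) (r M : R) :
  0 < r -> f (RtoC 0) = RtoC 0 -> is_derive (K := C_AbsRing) f (RtoC 0) l ->
  (forall w, Cmod w <= r -> ex_derive (K := C_AbsRing) (V := C_NormedModule) f w) ->
  (forall w, Cmod w <= r -> Cmod (f w) <= M) ->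
  Re l <= M / r.
Proof.
  intros hr hf0 hl hdiff hM.
  assert (h2pi : 0 < 2 * PI) by (pose proof PI_RGT_0; lra).
  assert (hcont : forall s, 0 < s <= r -> ex_RInt (polar_re f s) 0 (2 * PI)).
  { intros s hs; apply (ex_RInt_continuous (V := R_CompleteNormedModule)).
    intros t _.
    destruct (polar_divergence_free f s t) as (k & lA & lB & h & _);
      [lra|apply hdiff; rewrite Cmod_polar; lra|].
    exact (differentiable_continuous_y _ _ _ _ _ h). }
  apply le_epsilon; intros eps heps.
  destruct (is_derive_C_eps f _ l hl eps heps) as (d & hd0 & hd).
  (* The polar integrand is singular at radius 0, so the rectangle stops at a radius [s] where the
     first-order expansion of [f] at 0 already holds up to [eps]. *)
  set (s := Rmin (d / 2) r).
  assert (hs0 : 0 < s) by (apply Rmin_pos; lra).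
  assert (hsr : s <= r) by apply Rmin_r.
  assert (hsd : s < d) by (pose proof (Rmin_l (d / 2) r); unfold s; lra).
  assert (hdiv : RInt (polar_re f r) 0 (2 * PI) = RInt (polar_re f s) 0 (2 * PI)).
  { pose proof (rectangle_divergence (polar_re f) (polar_im f) s r 0 (2 * PI)
      hsr (Rlt_le _ _ h2pi)) as h.
    (* The sides t = 0 and t = 2 pi are the same segment of the disk, so their contributions
       cancel. *)
    rewrite (RInt_ext (fun x => polar_im f x (2 * PI)) (fun x => polar_im f x 0)) in h.
    - enough (RInt (polar_re f r) 0 (2 * PI) - RInt (polar_re f s) 0 (2 * PI) = 0)
        by lra.
      rewrite h; [ring|].
      intros x y hx hy; apply polar_divergence_free; [lra|].
      apply hdiff; rewrite Cmod_polar; lra.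
    - intros x _; unfold polar_im; rewrite cos_2PI, sin_2PI, cos_0, sin_0; reflexivity. }
  assert (hbig : Rabs (RInt (polar_re f r) 0 (2 * PI)) <= (2 * PI - 0) * (M / r)).
  { apply abs_RInt_le_const; [lra|apply hcont; lra|].
    intros t _; unfold polar_re.
    rewrite Rabs_mult, Rabs_inv, (Rabs_pos_eq r) by lra.
    apply Rmult_le_compat_r; [apply Rlt_le, Rinv_0_lt_compat; lra|].
    eapply Rle_trans; [apply rotate_re_le|].
    apply hM; rewrite Cmod_polar; lra. }
  assert (hsmall : Rabs (RInt (polar_re f s) 0 (2 * PI) - Re l * (2 * PI - 0))
                   <= (2 * PI - 0) * eps).
  { apply RInt_near_const; [lra|apply hcont; lra|].
    intros t _; unfold polar_re.
    set (w := (s * cos t, s * sin t) : C).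
    assert (hw : Cmod w = s) by (apply Cmod_polar; lra).
    assert (hfw : Cmod (f w - l * w) <= eps * s).
    { specialize (hd w); rewrite hf0 in hd.
      replace (w - RtoC 0)%C with w in hd by ring.
      replace (f w - RtoC 0 - l * w)%C with (f w - l * w)%C in hd by ring.
      rewrite hw in hd; apply hd; lra. }
    (* Since l w / w = l, subtracting [Re l] amounts to replacing [f w] by [f w - l * w] in
       [polar_re]. *)
    replace (_ - Re l)
      with ((Re (f w - l * w) * cos t + Im (f w - l * w) * sin t) * / s).
    - rewrite Rabs_mult, Rabs_inv, (Rabs_pos_eq s) by lra.
      apply (Rmult_le_reg_r s); [lra|].
      rewrite Rmult_assoc, Rinv_l, Rmult_1_r by lra.
      eapply Rle_trans; [apply rotate_re_le|exact hfw].
    - apply (Rmult_eq_reg_r s); [|lra].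
      rewrite Rmult_minus_distr_r, !Rmult_assoc, !Rinv_l, !Rmult_1_r by lra.
      replace (Re (f w - l * w)) with (Re (f w) - (Re l * (s * cos t) - Im l * (s * sin t)))
        by (unfold w, Re, Im; destruct l; simpl; ring).
      replace (Im (f w - l * w)) with (Im (f w) - (Re l * (s * sin t) + Im l * (s * cos t)))
        by (unfold w, Re, Im; destruct l; simpl; ring).
      assert (hcs : sin t * sin t = 1 - cos t * cos t)
        by (pose proof (sin2_cos2 t) as h; unfold Rsqr in h; lra).
      ring_simplify.
      replace (sin t ^ 2) with (1 - cos t * cos t) by (rewrite <- hcs; ring).
      ring. }
  rewrite hdiv in hbig.
  assert (h : (2 * PI) * Re l <= (2 * PI) * (M / r + eps)) by (split_Rabs; lra).
  apply (Rmult_le_reg_l (2 * PI)); assumption.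
Qed.

(** Reduction to the origin through [g]: the rotation [c] makes the derivative at 0 equal to its
    modulus, and subtracting [f z] makes [g] vanish at 0, at the cost of the factor 2. *)
Lemma cauchy_estimate (f : C -> C) (z : C) (r M : R) :
  0 < r ->
  (forall w, Cmod (w - z) <= r -> ex_derive (K := C_AbsRing) (V := C_NormedModule) f w) ->
  (forall w, Cmod (w - z) <= r -> Cmod (f w) <= M) ->
  Cmod (C_derive f z) <= 2 * M / r.
Proof.
  intros hr hdiff hM.
  assert (hzz : Cmod (z - z) <= r).
  { replace (z - z)%C with (RtoC 0) by ring; rewrite Cmod_0; lra. }
  assert (hl := C_derive_correct f z z (hdiff z hzz)).
  set (l := C_derive f z) in *.
  assert (hMz := hM z hzz).
  destruct (ex_rotation_to_Cmod l) as (c & hc1 & hcl).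
  set (g := fun w : C => (c * (f (w + z) - f z))%C).
  assert (hg : forall w k,
    is_derive (K := C_AbsRing) (V := C_NormedModule) f (w + z)%C k ->
    is_derive (K := C_AbsRing) (V := C_NormedModule) g w (c * k)%C).
  { intros w k hk.
    assert (h1 : is_derive (K := C_AbsRing) (V := C_NormedModule)
                   (fun w => f (w + z)%C) w k).
    { rewrite <- (Cmult_1_l k); apply (is_derive_Ccomp f (fun w => (w + z)%C)); [exact hk|].
      rewrite <- (Cplus_0_r (RtoC 1)).
      apply is_derive_C_AbsRing.
      exact (is_derive_plus (K := C_AbsRing) (V := AbsRing_NormedModule C_AbsRing)
               (fun w => w) (fun _ => z) w _ _
               (is_derive_id (K := C_AbsRing) w)
               (is_derive_const (K := C_AbsRing) (V := AbsRing_NormedModule C_AbsRing) z w)). }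
    replace (c * k)%C with (c * (k - 0))%C by ring.
    apply (is_derive_Cscal c (fun w => f (w + z) - f z)%C).
    exact (is_derive_minus (K := C_AbsRing) (V := C_NormedModule)
               _ (fun _ => f z) w _ _ h1
               (is_derive_const (K := C_AbsRing) (V := C_NormedModule) (f z) w)). }
  assert (hin : forall w, Cmod w <= r -> Cmod (w + z - z) <= r).
  { intros w hw; replace (w + z - z)%C with w by ring; exact hw. }
  rewrite <- (re_RtoC (Cmod l)), <- hcl.
  apply (cauchy_estimate_at_zero g).
  - exact hr.
  - unfold g; rewrite Cplus_0_l; ring.
  - apply hg; rewrite Cplus_0_l; exact hl.
  - intros w hw; destruct (hdiff (w + z)%C (hin w hw)) as [k hk].
    exists (c * k)%C; apply hg, hk.
  - intros w hw; unfold g; rewrite Cmod_mult, hc1, Rmult_1_l.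
    eapply Rle_trans; [apply Cmod_triangle|]; rewrite Cmod_opp.
    pose proof (hM _ (hin w hw)); lra.
Qed.

(** * Growth of the eigenfunctions *)

Lemma Rpower_le_1 (x a : R) : 0 < x <= 1 -> 0 <= a -> Rpower x a <= 1.
Proof.
  intros hx ha; eapply Rle_trans; [apply (Rle_Rpower_l x 1); assumption|].
  unfold Rpower; rewrite ln_1, Rmult_0_r, exp_0; lra.
Qed.

Lemma disk_weight_bounds (z : C) :
  in_disk z -> 0 < 1 - Cmod z /\ 1 - Cmod z <= 1 - Cmod z ^ 2 /\
    1 - Cmod z ^ 2 <= 1 /\ 1 - Cmod z ^ 2 <= 2 * (1 - Cmod z).
Proof. unfold in_disk; intros hz; pose proof (Cmod_ge_0 z); nra. Qed.

(** Cauchy's estimate on a disk of radius comparable to the distance from [z] to the unit circle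
    costs exactly one power of the weight. *)
Lemma in_Bloch_of_growth (f : C -> C) (p K : R) :
  0 <= p -> holomorphic_on_disk f ->
  (forall z, in_disk z -> Cmod (f z) * Rpower (1 - Cmod z ^ 2) p <= K) ->
  in_Bloch (p + 1) f.
Proof.
  intros hp hf hK; split; [exact hf|].
  exists (8 * K * Rpower 4 p); intros z hz.
  destruct (disk_weight_bounds z hz) as (h1 & h2 & h3 & h4).
  (* For |w - z| <= r one has 1 - |w|^2 >= 1 - |w| >= (1 - |z|)/2 = r >= d, so the weight at [w] is
     at least a quarter of that at [z]. The constant 8 K 4^p comes from (4d)^(p+1) times 2 (K / d^p)
     / r, using d / r <= 1. *)
  set (d := (1 - Cmod z ^ 2) / 4).
  set (r := (1 - Cmod z) / 2).
  assert (hd : 0 < d) by (unfold d; lra).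
  assert (hr : d <= r) by (unfold d, r; lra).
  assert (hin : forall w, Cmod (w - z) <= r -> in_disk w /\ d <= 1 - Cmod w ^ 2).
  { intros w hw.
    assert (hwz : Cmod w <= Cmod (w - z) + Cmod z).
    { eapply Rle_trans; [|apply Cmod_triangle].
      right; f_equal; ring. }
    assert (hw1 : in_disk w) by (unfold in_disk; unfold r in *; lra).
    split; [exact hw1|].
    destruct (disk_weight_bounds w hw1) as (_ & h6 & _).
    unfold r, d in *; lra. }
  assert (hpd : 0 < Rpower d p) by apply exp_pos.
  assert (hest : Cmod (C_derive f z) <= 2 * (K / Rpower d p) / r).
  { apply cauchy_estimate; [lra| |].
    - intros w hw; apply hf, hin, hw.
    - intros w hw; destruct (hin w hw) as [hw1 hw2].
      apply (Rmult_le_reg_r (Rpower d p)); [exact hpd|].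
      replace (K / Rpower d p * Rpower d p) with K by (field; lra).
      eapply Rle_trans; [|apply (hK w hw1)].
      apply Rmult_le_compat_l; [apply Cmod_ge_0|].
      apply Rle_Rpower_l; lra. }
  assert (hK0 : 0 <= K).
  { eapply Rle_trans; [|apply (hK z hz)].
    apply Rmult_le_pos; [apply Cmod_ge_0|apply Rlt_le, exp_pos]. }
  replace (1 - Cmod z ^ 2) with (4 * d) by (unfold d; field).
  rewrite Rpower_plus, Rpower_1, <- Rpower_mult_distr by lra.
  assert (hp4 : 0 < Rpower 4 p) by apply exp_pos.
  apply (Rmult_le_compat_l (Rpower 4 p * Rpower d p * (4 * d))) in hest;
    [|apply Rlt_le; repeat apply Rmult_lt_0_compat; lra].
  eapply Rle_trans; [exact hest|].
  replace (Rpower 4 p * Rpower d p * (4 * d) * (2 * (K / Rpower d p) / r))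
    with (8 * K * Rpower 4 p * (d / r)) by (field; split; lra).
  rewrite <- (Rmult_1_r (8 * K * Rpower 4 p)) at 2.
  apply Rmult_le_compat_l; [apply Rmult_le_pos; lra|].
  apply (Rmult_le_reg_r r); [lra|].
  replace (d / r * r) with d by (field; lra); lra.
Qed.

Lemma lim_Cmod_le (F : nat -> C) (l : C) (M : R) :
  filterlim F eventually (locally l) -> (forall k, Cmod (F k) <= M) -> Cmod l <= M.
Proof.
  intros hF hM.
  assert (h : is_lim_seq (fun k => Cmod (F k)) (Cmod l)).
  { apply (filterlim_comp _ _ _ F Cmod eventually (locally (l : C_UniformSpace))).
    - exact hF.
    - apply (filterlim_norm (V := C_NormedModule)). }
  exact (is_lim_seq_le _ (fun _ => M) (Cmod l) M hM h (is_lim_seq_const M)).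
Qed.

(** * Iterates, and products along an orbit *)

Lemma in_disk_iterate (phi : C -> C) (k : nat) (z : C) :
  holomorphic_self_map phi -> in_disk z -> in_disk (iterate phi k z).
Proof.
  intros [_ hphi] hz; induction k as [|k IH]; [exact hz|].
  apply (hphi _ IH).
Qed.

(** The weights telescope along the orbit of [z]. Used with [g] equal to [u] and to the derivative
    of [phi], where [q] is the modulus of the value of [g] at 0. *)
Lemma weighted_Cprod_le (phi g : C -> C) (W : C -> R) (q : R) (z : C) (k : nat) :
  holomorphic_self_map phi -> 0 <= q ->
  (forall w, in_disk w -> Cmod (g w) * W w <= q * W (phi w)) -> in_disk z ->
  Cmod (Cprod (fun j => g (iterate phi j z)) k) * W z <= q ^ k * W (iterate phi k z).
Proof.
  intros hphi hq hg hz; induction k as [|k IH]; [simpl; rewrite Cmod_1; right; reflexivity|].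
  simpl Cprod; rewrite Cmod_mult, <- tech_pow_Rmult.
  set (w := iterate phi k z) in *.
  assert (hw := hg w (in_disk_iterate phi k z hphi hz)).
  change (iterate phi (S k) z) with (phi w).
  apply (Rmult_le_compat_r (Cmod (g w)) _ _ (Cmod_ge_0 _)) in IH.
  apply (Rmult_le_compat_l (q ^ k) _ _ (pow_le q k hq)) in hw.
  lra.
Qed.

Lemma is_derive_iterate (phi : C -> C) (k : nat) (z : C) :
  holomorphic_self_map phi -> in_disk z ->
  is_derive (K := C_AbsRing) (V := C_NormedModule) (iterate phi k) z
    (Cprod (fun j => C_derive phi (iterate phi j z)) k).
Proof.
  intros hphi hz; induction k as [|k IH].
  - apply is_derive_C_AbsRing, (is_derive_id (K := C_AbsRing)).
  - apply (is_derive_Ccomp phi (iterate phi k)); [|exact IH].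
    apply (C_derive_correct phi _ (RtoC 0)), hphi.
    apply in_disk_iterate; assumption.
Qed.

(* [K * (1 - (1 - r)^(1 - a)) / (1 - a)] is the integral of [K * (1 - t)^(-a)]
   over [0, r]. *)
Lemma radial_growth (F D : C -> C) (a K : R) (z : C) :
  a <> 1 -> F (RtoC 0) = RtoC 0 ->
  (forall w, in_disk w -> is_derive (K := C_AbsRing) (V := C_NormedModule) F w (D w)) ->
  (forall w, in_disk w -> Cmod (D w) * Rpower (1 - Cmod w) a <= K) ->
  in_disk z ->
  Cmod (F z) <= K * ((1 - Rpower (1 - Cmod z) (1 - a)) / (1 - a)).
Proof.
  intros ha hF0 hF hD hz.
  destruct (ex_rotation_to_Cmod (F z)) as (c & hc1 & hcF).
  assert (hr0 := Cmod_ge_0 z); set (r := Cmod z) in *.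
  assert (hr1 : r < 1) by exact hz.
  assert (hseg : forall t, 0 <= t <= 1 -> Cmod (t * Re z, t * Im z) = t * r).
  { intros t ht; transitivity (Cmod (RtoC t * z)).
    - f_equal; destruct z; unfold Re, Im, Cmult, RtoC; simpl; f_equal; ring.
    - rewrite Cmod_mult, Cmod_R, Rabs_pos_eq by lra; reflexivity. }
  assert (hsegd : forall t, 0 <= t <= 1 -> in_disk (t * Re z, t * Im z)).
  { intros t ht; unfold in_disk; rewrite hseg by exact ht; nra. }
  (* The mean value theorem replaces integration: [h] is a primitive of the bound minus the rotated
     real part of [F] along the radius. As [dh] is nonnegative, [h 0 <= h 1], which is the claim. *)
  set (h := fun t => K * (- Rpower (1 - t * r) (1 - a) / (1 - a))
                     - Re (c * F (t * Re z, t * Im z))).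
  set (dh := fun t => K * (r * Rpower (1 - t * r) (- a))
                     - Re (c * D (t * Re z, t * Im z) * z)).
  assert (hder : forall t, 0 <= t <= 1 -> is_derive h t (dh t)).
  { intros t ht; unfold h, dh.
    apply (is_derive_minus (fun t => K * (- Rpower (1 - t * r) (1 - a) / (1 - a)))
             (fun t => Re (c * F (t * Re z, t * Im z)))).
    - assert (htr : 0 < 1 - t * r) by nra.
      unfold Rpower; auto_derive; [exact htr|].
      replace (- a * ln (1 - t * r)) with ((1 - a) * ln (1 - t * r) + - ln (1 - t * r))
        by ring.
      rewrite exp_plus, exp_Ropp, exp_ln by exact htr.
      replace (1 + - (t * r)) with (1 - t * r) by ring.
      field; split; lra.
    - apply is_derive_Reals.
      destruct (differentiable_pt_lim_Re_Im (fun w => c * F w)%C _ _ _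
        (is_derive_Cscal c F _ _ (hF _ (hsegd t ht)))) as [h1 _].
      replace (Re (c * D (t * Re z, t * Im z) * z))
        with (Re (c * D (t * Re z, t * Im z)) * Re z
              + - Im (c * D (t * Re z, t * Im z)) * Im z)
        by (unfold Re, Im; simpl; ring).
      apply (derivable_pt_lim_comp_2d (fun u v => Re (c * F (u, v)))
               (fun t => t * Re z) (fun t => t * Im z)); [exact h1| |];
        apply is_derive_Reals; auto_derive; auto; ring. }
  assert (hpos : forall t, 0 <= t <= 1 -> 0 <= dh t).
  { intros t ht; unfold dh.
    set (w := (t * Re z, t * Im z) : C).
    assert (hw := hD w (hsegd t ht)); unfold w in hw at 2; rewrite hseg in hw by exact ht.
    assert (hinv : Rpower (1 - t * r) a * Rpower (1 - t * r) (- a) = 1).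
    { rewrite <- Rpower_plus, Rplus_opp_r; apply Rpower_O; nra. }
    assert (hp : 0 < Rpower (1 - t * r) (- a)) by apply exp_pos.
    apply (Rmult_le_compat_r (Rpower (1 - t * r) (- a))) in hw; [|lra].
    rewrite Rmult_assoc, hinv, Rmult_1_r in hw.
    apply (Rmult_le_compat_r r) in hw; [|lra].
    assert (hre := re_le_Cmod (c * D w * z)).
    rewrite !Cmod_mult, hc1 in hre; fold r in hre.
    split_Rabs; lra. }
  destruct (MVT_gen h 0 1 dh) as (s & hs & hmvt).
  - intros t ht; rewrite Rmin_left, Rmax_right in ht by lra; apply hder; lra.
  - intros t ht; rewrite Rmin_left, Rmax_right in ht by lra.
    apply continuity_pt_filterlim, (ex_derive_continuous h).
    exists (dh t); apply hder; lra.
  - rewrite Rmin_left, Rmax_right in hs by lra.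
    specialize (hpos s hs).
    assert (hh : h 0 <= h 1) by lra.
    unfold h in hh.
    replace (0 * Re z, 0 * Im z) with (RtoC 0) in hh
      by (unfold RtoC; f_equal; ring).
    replace (1 * Re z, 1 * Im z) with z in hh
      by (destruct z; unfold Re, Im; simpl; f_equal; ring).
    rewrite hF0, hcF, Cmult_0_r, !re_RtoC, Rmult_0_l, Rmult_1_l, !Rminus_0_r in hh.
    replace (Rpower 1 (1 - a)) with 1 in hh
      by (unfold Rpower; rewrite ln_1, Rmult_0_r, exp_0; reflexivity).
    unfold Rdiv in *; lra.
Qed.

(** Two exponents are kept apart: [b] is the one in the hypothesis, and [a] is the one integrated,
    which must differ from 1. The factor |phi'(0)|^k from the orbit product cancels the
    normalization, so the bound passes to the limit. *)
Lemma Koenigs_function_growth (phi sigma : C -> C) (a b : R) (z : C) :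
  holomorphic_self_map phi -> phi (RtoC 0) = RtoC 0 ->
  0 < Cmod (C_derive phi (RtoC 0)) ->
  is_Koenigs_function phi sigma -> 0 <= b <= a -> a <> 1 ->
  (forall w, in_disk w ->
     Cmod (C_derive phi w) * Rpower (1 - Cmod w ^ 2) b
     <= Cmod (C_derive phi (RtoC 0)) * Rpower (1 - Cmod (phi w) ^ 2) b) ->
  in_disk z ->
  Cmod (sigma z) <= (1 - Rpower (1 - Cmod z) (1 - a)) / (1 - a).
Proof.
  intros hphi hphi0 hlam [_ hlim] hab ha1 hb hz.
  apply (lim_Cmod_le _ _ _ (hlim z hz)); intros k.
  set (lam := C_derive phi (RtoC 0)) in *.
  assert (hlamk : 0 < Cmod lam ^ k) by (apply pow_lt, hlam).
  rewrite Cmod_div, Cmod_pow.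
  2:{ apply Cmod_gt_0; rewrite Cmod_pow; exact hlamk. }
  apply (Rmult_le_reg_r (Cmod lam ^ k)); [exact hlamk|].
  replace (Cmod (iterate phi k z) / Cmod lam ^ k * Cmod lam ^ k)
    with (Cmod (iterate phi k z)) by (field; lra).
  rewrite Rmult_comm.
  apply (radial_growth (iterate phi k)
    (fun w => Cprod (fun j => C_derive phi (iterate phi j w)) k)); try assumption.
  - induction k as [|k IH]; [reflexivity|].
    change (iterate phi (S k) (RtoC 0)) with (phi (iterate phi k (RtoC 0))).
    rewrite IH by (apply pow_lt, hlam); exact hphi0.
  - intros w hw; apply is_derive_iterate; assumption.
  - intros w hw.
    destruct (disk_weight_bounds w hw) as (h1 & h2 & h3 & _).
    pose proof (weighted_Cprod_le phi (C_derive phi) (fun w => Rpower (1 - Cmod w ^ 2) b)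
      (Cmod lam) w k hphi (Rlt_le _ _ hlam) hb hw) as hprod.
    eapply Rle_trans; [|eapply Rle_trans; [exact hprod|]].
    + apply Rmult_le_compat_l; [apply Cmod_ge_0|].
      (* (1 - |w|)^a <= (1 - |w|^2)^a <= (1 - |w|^2)^b, the last step because the base is at most 1
         and [b <= a]. *)
      eapply Rle_trans; [apply (Rle_Rpower_l _ (1 - Cmod w ^ 2)); lra|].
      replace a with (b + (a - b)) by ring; rewrite Rpower_plus.
      rewrite <- (Rmult_1_r (Rpower _ b)) at 2.
      apply Rmult_le_compat_l; [apply Rlt_le, exp_pos|apply Rpower_le_1; lra].
    + rewrite <- (Rmult_1_r (Cmod lam ^ k)) at 2.
      apply Rmult_le_compat_l; [lra|].
      destruct (disk_weight_bounds _ (in_disk_iterate phi k w hphi hw)) as (g1 & g2 & g3 & _).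
      apply Rpower_le_1; lra.
Qed.

(** Telescoping bounds |v_k(z)| (1 - |z|^2)^b by (1 - |phi_k(z)|^2)^b <= 1 for every k, and the
    limit inherits the bound. *)
Lemma principal_eigenfunction_growth (u phi v : C -> C) (b : R) (z : C) :
  holomorphic_self_map phi -> u (RtoC 0) <> RtoC 0 ->
  is_principal_eigenfunction u phi v -> 0 <= b ->
  (forall w, in_disk w ->
     Cmod (u w) * Rpower (1 - Cmod w ^ 2) b
     <= Cmod (u (RtoC 0)) * Rpower (1 - Cmod (phi w) ^ 2) b) ->
  in_disk z -> Cmod (v z) * Rpower (1 - Cmod z ^ 2) b <= 1.
Proof.
  intros hphi hu0 [_ hlim] hb hu hz.
  assert (hW : 0 < Rpower (1 - Cmod z ^ 2) b) by apply exp_pos.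
  apply (Rmult_le_reg_r (/ Rpower (1 - Cmod z ^ 2) b)); [apply Rinv_0_lt_compat, hW|].
  rewrite Rmult_assoc, Rinv_r, Rmult_1_r, Rmult_1_l by lra.
  apply (lim_Cmod_le _ _ _ (hlim z hz)); intros k.
  apply Cmod_gt_0 in hu0.
  assert (huk : 0 < Cmod (u (RtoC 0)) ^ k) by (apply pow_lt, hu0).
  rewrite Cmod_div, Cmod_pow.
  2:{ apply Cmod_gt_0; rewrite Cmod_pow; exact huk. }
  pose proof (weighted_Cprod_le phi u (fun w => Rpower (1 - Cmod w ^ 2) b)
    (Cmod (u (RtoC 0))) z k hphi (Rlt_le _ _ hu0) hu hz) as hprod.
  assert (h1 : Rpower (1 - Cmod (iterate phi k z) ^ 2) b <= 1).
  { destruct (disk_weight_bounds _ (in_disk_iterate phi k z hphi hz)) as (g1 & g2 & g3 & _).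
    apply Rpower_le_1; lra. }
  apply (Rmult_le_reg_r (Cmod (u (RtoC 0)) ^ k * Rpower (1 - Cmod z ^ 2) b)).
  { apply Rmult_lt_0_compat; assumption. }
  apply (Rmult_le_compat_l (Cmod (u (RtoC 0)) ^ k)) in h1; [|lra].
  field_simplify; [|lra|lra].
  lra.
Qed.

Lemma holomorphic_mult_pow (f g : C -> C) (n : nat) :
  holomorphic_on_disk f -> holomorphic_on_disk g ->
  holomorphic_on_disk (fun z => (f z * Cpow (g z) n)%C).
Proof.
  intros hf hg z hz.
  destruct (hf z hz) as [df hdf]; destruct (hg z hz) as [dg hdg].
  assert (hpow : exists l, is_derive (K := C_AbsRing) (V := C_NormedModule)
                             (fun w => Cpow (g w) n) z l).
  { induction n as [|n [l IH]].
    - eexists; exact (is_derive_const (K := C_AbsRing) (V := C_NormedModule) (RtoC 1) z).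
    - eexists; exact (is_derive_Cmult g (fun w => Cpow (g w) n) z _ _ hdg IH). }
  destruct hpow as [l hl]; eexists.
  exact (is_derive_Cmult f (fun w => Cpow (g w) n) z _ _ hdf hl).
Qed.

Theorem theorem4p3 (phi u sigma v : C -> C) (beta : R)
  (hphi : holomorphic_self_map phi)
  (hphi0 : phi (RtoC 0) = RtoC 0)
  (hdphi0 : 0 < Cmod (C_derive phi (RtoC 0)) < 1)
  (hu : holomorphic_on_disk u)
  (hu0 : u (RtoC 0) <> RtoC 0)
  (hsigma : is_Koenigs_function phi sigma)
  (hv : is_principal_eigenfunction u phi v)
  (hbeta : 0 < beta)
  (hub : forall z : C, in_disk z ->
     Cmod (u z) * (Rpower (1 - Cmod z ^ 2) beta
                   / Rpower (1 - Cmod (phi z) ^ 2) beta)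
     <= Cmod (u (RtoC 0))) :
  ((exists alpha : R, 0 < alpha < 1 /\
      forall z : C, in_disk z ->
        Rpower (1 - Cmod z ^ 2) alpha * Cmod (C_derive phi z)
          / Rpower (1 - Cmod (phi z) ^ 2) alpha
        <= Cmod (C_derive phi (RtoC 0))) ->
   forall n : nat,
     in_Bloch (beta + 1) (fun z => (v z * Cpow (sigma z) n)%C))
  /\
  ((forall z : C, in_disk z ->
      (1 - Cmod z ^ 2) * Cmod (C_derive phi z) / (1 - Cmod (phi z) ^ 2)
      <= Cmod (C_derive phi (RtoC 0))) ->
   exists p : R, beta < p /\
     forall n : nat,
       in_Bloch (p + 1) (fun z => (v z * Cpow (sigma z) n)%C)).
Proof.
  assert (hW : forall b w, 0 < Rpower (1 - Cmod w ^ 2) b) by (intros; apply exp_pos).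
  destruct hdphi0 as [hlam _].
  assert (hv1 : forall z, in_disk z -> Cmod (v z) * Rpower (1 - Cmod z ^ 2) beta <= 1).
  { intros z hz; apply (principal_eigenfunction_growth u phi); auto; [lra|].
    intros w hw; specialize (hub w hw); specialize (hW beta (phi w)).
    apply (Rmult_le_compat_r _ _ _ (Rlt_le _ _ hW)) in hub.
    field_simplify in hub; lra. }
  assert (hhol : forall n, holomorphic_on_disk (fun z => (v z * Cpow (sigma z) n)%C)).
  { intros n; apply holomorphic_mult_pow; [apply hv|apply hsigma]. }
  split.
  - intros (alpha & halpha & hphi') n.
    assert (hs : forall z, in_disk z -> Cmod (sigma z) <= / (1 - alpha)).
    { intros z hz.
      eapply Rle_trans;
        [apply (Koenigs_function_growth phi sigma alpha alpha z); auto; try lra|].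
      - intros w hw; specialize (hphi' w hw); specialize (hW alpha (phi w)).
        apply (Rmult_le_compat_r _ _ _ (Rlt_le _ _ hW)) in hphi'.
        field_simplify in hphi'; lra.
      - rewrite <- (Rmult_1_l (/ (1 - alpha))).
        apply Rmult_le_compat_r; [apply Rlt_le, Rinv_0_lt_compat; lra|].
        pose proof (exp_pos ((1 - alpha) * ln (1 - Cmod z))); unfold Rpower; lra. }
    apply (in_Bloch_of_growth _ _ ((/ (1 - alpha)) ^ n)); [lra|apply hhol|].
    intros z hz; rewrite Cmod_mult, Cmod_pow.
    pose proof (pow_incr _ _ n (conj (Cmod_ge_0 (sigma z)) (hs z hz))) as hn.
    pose proof (pow_le _ n (Cmod_ge_0 (sigma z))) as hn0.
    specialize (hv1 z hz).
    apply (Rmult_le_compat_r _ _ _ hn0) in hv1; lra.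
  - intros hphi'; exists (beta + 1); split; [lra|]; intros n.
    set (g := / (INR n + 1)).
    assert (hn0 := pos_INR n).
    assert (hg : 0 < g) by (apply Rinv_0_lt_compat; lra).
    assert (hs : forall z, in_disk z -> Cmod (sigma z) <= / g * Rpower (1 - Cmod z) (- g)).
    { intros z hz.
      eapply Rle_trans;
        [apply (Koenigs_function_growth phi sigma (1 + g) 1 z); auto; try lra|].
      - intros w hw; specialize (hphi' w hw).
        destruct (disk_weight_bounds w hw) as (h1 & h2 & _).
        destruct (disk_weight_bounds _ (proj2 hphi w hw)) as (g1 & g2 & _).
        rewrite !Rpower_1 by lra.
        apply (Rmult_le_compat_r (1 - Cmod (phi w) ^ 2)) in hphi'; [|lra].
        field_simplify in hphi'; lra.
      - replace (1 - (1 + g)) with (- g) by ring.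
        replace ((1 - Rpower (1 - Cmod z) (- g)) / - g)
          with (/ g * Rpower (1 - Cmod z) (- g) - / g) by (field; lra).
        apply Rinv_0_lt_compat in hg; lra. }
    (* The power comes from the constant in [hs], the 2 from 1 - |z|^2 <= 2 (1 - |z|). *)
    apply (in_Bloch_of_growth _ _ ((/ g) ^ n * 2)); [lra|apply hhol|].
    intros z hz; rewrite Cmod_mult, Cmod_pow.
    destruct (disk_weight_bounds z hz) as (h1 & h2 & h3 & h4).
    rewrite Rpower_plus, Rpower_1 by lra.
    pose proof (pow_incr _ _ n (conj (Cmod_ge_0 (sigma z)) (hs z hz))) as hn.
    pose proof (pow_le _ n (Cmod_ge_0 (sigma z))) as hs0.
    rewrite Rpow_mult_distr in hn.
    rewrite <- (Rpower_pow n (Rpower _ _)), Rpower_mult in hn by apply exp_pos.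
    (* The choice of [g] pays off here: the total exponent 1 - n g equals g, which is positive. *)
    assert (hone : Rpower (1 - Cmod z) (- g * INR n) * (1 - Cmod z) <= 1).
    { rewrite <- (Rpower_1 (1 - Cmod z)) at 2 by lra.
      rewrite <- Rpower_plus; apply Rpower_le_1; [pose proof (Cmod_ge_0 z); lra|].
      replace (- g * INR n + 1) with g by (unfold g; field; lra); lra. }
    assert (hgn : 0 < (/ g) ^ n) by (apply pow_lt, Rinv_0_lt_compat, hg).
    set (s := Cmod (sigma z) ^ n) in *.
    set (W := Rpower (1 - Cmod z ^ 2) beta) in *.
    set (P := Rpower (1 - Cmod z) (- g * INR n)) in *.
    assert (hsP : s * (1 - Cmod z ^ 2) <= (/ g) ^ n * 2).
    { eapply Rle_trans; [apply (Rmult_le_compat_l s _ _ hs0 h4)|].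
      apply (Rmult_le_compat_r (2 * (1 - Cmod z))) in hn; [|lra].
      eapply Rle_trans; [exact hn|].
      replace ((/ g) ^ n * P * (2 * (1 - Cmod z)))
        with ((/ g) ^ n * (2 * (P * (1 - Cmod z)))) by ring.
      apply Rmult_le_compat_l; lra. }
    replace (Cmod (v z) * s * (W * (1 - Cmod z ^ 2)))
      with (Cmod (v z) * W * (s * (1 - Cmod z ^ 2))) by ring.
    eapply Rle_trans; [|exact hsP].
    rewrite <- (Rmult_1_l (s * _)) at 2.
    apply Rmult_le_compat_r; [apply Rmult_le_pos; lra|apply hv1, hz].
Qed.
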